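(* Let $k\ge 2$, $s\ge 0$ and $n\ge 1$ be integers. If $n\ge 2s+1$, then the maximum possible number of edges of a graph on $n$ vertices with clique number at most $k$ and matching number at most $s$ is equal to $$\max\{\,t(2s+1,k),\; g(n,k,s)\,\}.$$ (If $n\le 2s+1$, then this maximum is $t(n,k)$.)
   Context: All graphs are finite and simple. The clique number of a graph $G$ is the maximum number of vertices in a complete subgraph of $G$. The matching number of $G$ is the maximum cardinality of a matching in $G$ (a set of pairwise disjoint edges). A graph is called complete $k$-partite if its vertex set is the union of $k$ pairwise disjoint sets (vertex classes), some of which may be empty, and two vertices are adjacent if and only if they belong to distinct classes. $T(n,k)$ denotes the complete $k$-partite graph on $n$ vertices in which the sizes of the $k$ vertex classes are as equal as possible (any two differ by at most $1$), and $t(n,k)$ denotes its number of edges. For $k\ge 2$ and $n\ge s$, $G(n,k,s)$ denotes the complete $k$-partite graph on $n$ vertices consisting of $k-1$ vertex classes of sizes as equal as possible (any two of these $k-1$ sizes differ by at most $1$) whose total size is $s$, and one additional vertex class of size $n-s$. Its number of edges is denoted $g(n,k,s)$. *)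

(* Defs.v *)
From mathcomp Require Import all_boot.

Set Implicit Arguments.
Unset Strict Implicit.
Unset Printing Implicit Defensive.

Record sgraph := SGraph {
  svertex :> finType;
  sedge : rel svertex;
  sedge_sym : symmetric sedge;
  sedge_irrefl : irreflexive sedge
}.

Definition edges (G : sgraph) : {set {set G}} :=
  [set [set x; y] | x in G, y in G & sedge x y].

Definition num_edges (G : sgraph) : nat := #|edges G|.

Definition is_clique (G : sgraph) (A : {set G}) : bool :=
  [forall x in A, forall y in A, (x != y) ==> sedge x y].

Definition clique_number (G : sgraph) : nat :=
  \max_(A : {set G} | is_clique A) #|A|.

Definition is_matching (G : sgraph) (M : {set {set G}}) : bool :=
  (M \subset edges G) && trivIset M.

Definition matching_number (G : sgraph) : nat :=
  \max_(M : {set {set G}} | is_matching M) #|M|.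

Definition cm_rel (k : nat) (a : nat -> nat) : rel {i : 'I_k & 'I_(a i)} :=
  fun x y => tag x != tag y.

Lemma cm_sym k a : symmetric (@cm_rel k a).
Proof. by move=> x y; rewrite /cm_rel eq_sym. Qed.

Lemma cm_irrefl k a : irreflexive (@cm_rel k a).
Proof. by move=> x; rewrite /cm_rel eqxx. Qed.

(* Class sizes are [a 0], ..., [a k.-1]; a vertex is a class index together
   with a position in that class, and empty classes are allowed. *)
Definition complete_multipartite (k : nat) (a : nat -> nat) : sgraph :=
  SGraph (@cm_sym k a) (@cm_irrefl k a).

Lemma card_complete_multipartite k a :
  #|complete_multipartite k a| = \sum_(i < k) a i.
Proof.
rewrite card_tagged sumnE big_map big_enum.
by apply: eq_bigr => i _; rewrite card_ord.
Qed.

(* The sizes, for [i < k], of [k] classes as equal as possible of total [n]. *)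
Definition balanced (n k i : nat) : nat := n %/ k + (i < n %% k).

Lemma balanced_diff n k i j : balanced n k i <= (balanced n k j).+1.
Proof. by rewrite /balanced -addnS leq_add2l; case: (i < _). Qed.

Lemma balanced_sum n k : 0 < k -> \sum_(i < k) balanced n k i = n.
Proof.
move=> k0; rewrite big_split /= sum_nat_const card_ord.
rewrite -(big_mkord xpredT (fun i => nat_of_bool (i < n %% k))).
have le_rk : n %% k <= k by rewrite ltnW ?ltn_mod.
rewrite (big_cat_nat (leq0n _) le_rk) /= [X in _ + (_ + X)]big_nat.
rewrite [X in _ + (_ + X)]big1 => [|i /andP[le_ri _]]; last by rewrite ltnNge le_ri.
rewrite (eq_big_nat _ _ (F2 := fun=> 1)) => [|i /andP[_ ->]] //.
by rewrite sum_nat_const_nat subn0 muln1 addn0 mulnC [RHS](divn_eq n k) mulnC.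
Qed.

Definition turan_graph (n k : nat) : sgraph :=
  complete_multipartite k (balanced n k).

Definition t (n k : nat) : nat := num_edges (turan_graph n k).

Definition G_size (n k s i : nat) : nat :=
  if i < k.-1 then balanced s k.-1 i else n - s.

(* Meaningful for [1 < k] and [s <= n]. *)
Definition G_graph (n k s : nat) : sgraph :=
  complete_multipartite k (G_size n k s).

Definition g (n k s : nat) : nat := num_edges (G_graph n k s).

Lemma card_turan_graph n k : 0 < k -> #|turan_graph n k| = n.
Proof. by move=> k0; rewrite card_complete_multipartite balanced_sum. Qed.

Lemma card_G_graph n k s : 1 < k -> s <= n -> #|G_graph n k s| = n.
Proof.
case: k => [//|[//|k]] _ le_sn; rewrite card_complete_multipartite big_ord_recr /=.
rewrite {2}/G_size /= ltnn -[RHS](subnKC le_sn); congr (_ + _).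
rewrite -[RHS](@balanced_sum s k.+1) //; apply: eq_bigr => i _.
by rewrite /G_size /= ltn_ord.
Qed.

Definition admissible (n k s : nat) (G : sgraph) : Prop :=
  [/\ #|G| = n, clique_number G <= k & matching_number G <= s].

Definition is_max_num_edges (n k s m : nat) : Prop :=
  (exists2 G : sgraph, admissible n k s G & num_edges G = m) /\
  (forall G : sgraph, admissible n k s G -> num_edges G <= m).

(* Main.v *)
(* By a Tutte-Berge type structure theorem, [G] with matching number at most [s]
   has a set [B] such that [G - B] splits into [q] unions of components with
   [n + |B| <= 2 s + q].  Let [v] be a vertex of maximum degree outside [B].
   Deleting every part other than that of [v] and then cloning [v] (or just
   deleting vertices outside [B], if [v] has degree at most [|B|]) never gains
   a clique, so Turan's theorem yields
     [e(G) <= t(M, k) + (n - M) |B|]  for all  [2 s + 1 - |B| <= M <= n].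
   Let [m = s + ceil(s / (k - 1))]; then [t(m, k) + (n - m) s = g(n, k, s)].
   If [m + |B| >= 2 s + 1], take [M = m].  Otherwise take [M = 2 s + 1 - |B|]:
   the bound is then convex in [|B|], and its values at the ends [|B| = 0] and
   [|B| = 2 s + 1 - m] are at most [t(2 s + 1, k)] and [g(n, k, s)]. *)
Require Import Defs.
From mathcomp Require Import all_boot.
From mathcomp Require Import zify.

Set Implicit Arguments.
Unset Strict Implicit.
Unset Printing Implicit Defensive.

(** * Turán's theorem for degree sums, by deleting and cloning vertices *)

(** A vertex added to a smallest class of $T(m,k)$, which has [m %/ k] vertices, gains [m - m %/ k]
    neighbours; summing gives $t(n,k)$, as [t_turan_num] confirms for [0 < k]. *)
Definition turan_num (k n : nat) : nat := \sum_(m < n) (m - m %/ k).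

Lemma turan_numS k n : turan_num k n.+1 = turan_num k n + (n - n %/ k).
Proof. by rewrite /turan_num big_ord_recr. Qed.

Definition deg (T : finType) (e : rel T) (X : {set T}) (x : T) : nat :=
  \sum_(y in X) e x y.

Definition degsum (T : finType) (e : rel T) (X : {set T}) : nat :=
  \sum_(x in X) deg e X x.

Definition clique_bounded (T : finType) (e : rel T) (k : nat) (X : {set T}) :=
  forall A : {set T}, A \subset X ->
    {in A &, forall x y, x != y -> e x y} -> #|A| <= k.

Lemma deg_le_card (T : finType) (e : rel T) (X A : {set T}) x :
  (forall y, y \in X -> e x y -> y \in A) -> deg e X x <= #|A|.
Proof.
move=> XA; rewrite /deg -sum1_card big_mkcond /= [leqRHS]big_mkcond /=.
apply: leq_sum => y _; case: ifP => // yX; case exy: (e x y) => //=.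
by rewrite (XA y yX exy).
Qed.

Lemma degS (T : finType) (e : rel T) (X Y : {set T}) x :
  X \subset Y -> deg e X x <= deg e Y x.
Proof.
move=> XY; rewrite /deg [leqRHS](big_setID X) /= (setIidPr XY); exact: leq_addr.
Qed.

(** An edge of [X] not inside [Y] has an end in [X :\: Y] and is counted by the degrees there; edges
    with both ends in [X :\: Y] are counted twice, hence only an inequality. *)
Lemma degsum_setD (T : finType) (e : rel T) (X Y : {set T}) :
  symmetric e -> Y \subset X ->
  degsum e X <= degsum e Y + 2 * \sum_(x in X :\: Y) deg e X x.
Proof.
move=> esym YX; rewrite {1}/degsum (big_setID Y) /= (setIidPr YX) mul2n -addnn.
rewrite addnA leq_add2r.
have degE x : deg e X x = deg e Y x + deg e (X :\: Y) x.
  by rewrite /deg (big_setID Y) /= (setIidPr YX).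
rewrite (eq_bigr _ (fun x _ => degE x)) big_split leq_add2l /=.
rewrite /deg exchange_big /= leq_sum // => x _.
rewrite (eq_bigr (fun y => nat_of_bool (e x y))) => [|y _]; last by rewrite esym.
exact: degS.
Qed.

Lemma clique_boundedS (T : finType) (e : rel T) k (X Y : {set T}) :
  Y \subset X -> clique_bounded e k X -> clique_bounded e k Y.
Proof. by move=> YX kX A AY; apply: kX; apply: subset_trans YX. Qed.

(* The non-neighbourhoods of the vertices of a maximum clique cover [X], so
   one of them has more than [n %/ k] elements. *)
Lemma exists_low_degree (T : finType) (e : rel T) k n (X : {set T}) :
  symmetric e -> irreflexive e -> 0 < k -> clique_bounded e k X ->
  #|X| = n.+1 -> exists2 x, x \in X & deg e X x <= n - n %/ k.
Proof.
move=> esym eirr k0 kX cX.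
pose P (A : {set T}) := (A \subset X) &&
  [forall x in A, forall y in A, (x != y) ==> e x y].
have P0 : P set0.
  by rewrite /P sub0set; apply/forallP => x; rewrite inE.
have PE A : P A -> {in A &, forall x y, x != y -> e x y}.
  case/andP=> _ /forall_inP h x y xA yA.
  by move/(_ _ xA): h => /forall_inP /(_ _ yA) /implyP.
case: (@arg_maxnP _ set0 P (fun A => #|A|) P0) => A PA maxA.
have [AX _] := andP PA.
have cA : #|A| <= k by apply: kX AX (PE _ PA).
pose N a := [set x in X | ~~ e a x].
(* A vertex adjacent to all of [A] would extend the maximum clique [A]. *)
have covX : X \subset \bigcup_(a in A) N a.
  apply/subsetP => x xX; apply/bigcupP.
  case: (pickP [pred a in A | ~~ e a x]) => [a /andP[aA nax]|none].
    by exists a; rewrite // inE xX.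
  have adj a : a \in A -> e a x.
    by move=> aA; move: (none a); rewrite /= aA => /negbFE.
  have xA : x \notin A by apply/negP => /adj; rewrite eirr.
  have : P (x |: A).
    rewrite /P subUset sub1set xX AX; apply/forall_inP => y yA.
    apply/forall_inP => z zA; apply/implyP.
    case/setU1P: yA => [->|yA]; case/setU1P: zA => [->|zA]; rewrite ?eqxx //.
    - by rewrite esym adj.
    - by rewrite adj.
    - exact: (PE _ PA).
  by move/maxA; rewrite cardsU1 xA /= => h; lia.
have : exists2 a, a \in A & n < #|N a| * k.
  case: (pickP [pred a in A | n < #|N a| * k]) => [a /andP[]|small].
    by exists a.
  have s1 : #|X| <= \sum_(a in A) #|N a|.
    apply: leq_trans (subset_leq_card covX) _.
    elim/big_rec2: _ => [|a m U _ Um]; first by rewrite cards0.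
    by rewrite (leq_trans (leq_card_setU _ _)) // leq_add2l.
  have s2 : (\sum_(a in A) #|N a|) * k <= #|A| * n.
    rewrite big_distrl -sum_nat_const leq_sum // => a aA.
    by rewrite leqNgt; move: (small a); rewrite /= aA /= => ->.
  (* If every [#|N a| * k] were at most [n], then [n.+1 * k <= #|A| * n <= k * n]. *)
  exfalso; have := leq_trans (leq_mul s1 (leqnn k)) (leq_trans s2 (leq_mul cA (leqnn n))).
  by rewrite cX mulnC leq_pmul2l // ltnn.
case=> a aA big; exists a; first exact: (subsetP AX).
have lt : n %/ k < #|N a| by rewrite ltn_divLR.
have dN : deg e X a + #|N a| = n.+1.
  rewrite -cX -(cardsID (N a) X) addnC; congr (_ + _).
    by apply: eq_card => x; rewrite !inE andbA andbb.
  rewrite /deg -sum1_card big_mkcond [RHS]big_mkcond; apply: eq_bigr => x _.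
  by rewrite !inE; case: (x \in X) => //; case: (e a x).
have := leq_div n k; lia.
Qed.

(** Deleting the vertex from [exists_low_degree] loses at most [n - n %/ k] edges, which is the last
    increment of [turan_num]. *)
Theorem turan_degsum (T : finType) (e : rel T) k (X : {set T}) :
  symmetric e -> irreflexive e -> 0 < k -> clique_bounded e k X ->
  degsum e X <= 2 * turan_num k #|X|.
Proof.
move=> esym eirr k0; move cX: #|X| => n; elim: n X cX => [|n IH] X cX kX.
  by rewrite (cards0_eq cX) /degsum big_set0.
have [x xX dx] := exists_low_degree esym eirr k0 kX cX.
have X'X : X :\ x \subset X by apply: subsetDl.
have cX' : #|X :\ x| = n by move: cX; rewrite (cardsD1 x) xX => -[].
have := IH _ cX' (clique_boundedS X'X kX).
have := degsum_setD esym X'X.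
have -> : X :\: (X :\ x) = [set x].
  by apply/setP => y; rewrite !inE; case: (y =P x) => [->|_]; rewrite ?xX /= ?andNb.
rewrite big_set1 turan_numS; lia.
Qed.

(** Turán's theorem is applied to the graph in which [v] gets [y] additional copies with the
    neighbours of [v]. Copies of [v] are pairwise non-adjacent, so a clique contains at most one of
    them and the clique bound survives. *)
Lemma turan_clones (T : finType) (e : rel T) k (X : {set T}) v y :
  symmetric e -> irreflexive e -> 0 < k -> clique_bounded e k X -> v \in X ->
  degsum e X + 2 * (y * deg e X v) <= 2 * turan_num k (#|X| + y).
Proof.
move=> esym eirr k0 kX vX.
pose f (p : T + 'I_y) := if p is inl x then x else v.
pose e' p q := e (f p) (f q).
pose X' := [set p | f p \in X].
have bigX' (F : T + 'I_y -> nat) :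
    \sum_(p in X') F p = \sum_(x in X) F (inl x) + \sum_(i < y) F (inr i).
  rewrite big_sumType /=; congr (_ + _); apply: eq_bigl => p; rewrite inE //=.
have cX' : #|X'| = #|X| + y.
  by rewrite -sum1_card bigX' sum1_card sum_nat_const card_ord muln1.
have degX' p : deg e' X' p = deg e X (f p) + y * e (f p) v.
  by rewrite /deg bigX' /e' /= sum_nat_const card_ord.
have dX' : degsum e' X' = degsum e X + 2 * (y * deg e X v).
  rewrite /degsum bigX' !(eq_bigr _ (fun p _ => degX' _)) /=.
  rewrite big_split /= sum_nat_const card_ord eirr muln0 addn0 -big_distrr /=.
  have -> : \sum_(x in X) e x v = deg e X v.
    by apply: eq_bigr => x _; rewrite esym.
  by rewrite /degsum; lia.
rewrite -dX' -cX'; apply: turan_degsum => //.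
- by move=> p q; apply: esym.
- by move=> p; apply: eirr.
move=> A AX' clA; have finj : {in A &, injective f}.
  move=> p q pA qA fpq; apply/eqP/negPn/negP => /(clA _ _ pA qA).
  by rewrite /e' fpq eirr.
rewrite -(card_in_imset finj); apply: kX.
  by apply/subsetP => _ /imsetP[p pA ->]; move/(subsetP AX'): pA; rewrite inE.
move=> _ _ /imsetP[p pA ->] /imsetP[q qA ->] npq; apply: (clA _ _ pA qA).
by apply: contraNneq npq => ->.
Qed.

(** * Matchings as involutions and the Tutte-Berge formula *)

(* A matching is encoded by the involution exchanging the ends of its edges
   and fixing the other vertices. *)
Definition matching_fun (T : finType) (e : rel T) (X : {set T})
    (f : {ffun T -> T}) : bool :=
  [forall x, (f (f x) == x) && ((f x != x) ==> (x \in X) && e x (f x))].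

Definition covered (T : finType) (f : {ffun T -> T}) : {set T} :=
  [set x | f x != x].

(** Twice the matching number of the graph induced on [X], as each edge covers two vertices. *)
Definition max_covered (T : finType) (e : rel T) (X : {set T}) : nat :=
  \max_(f | matching_fun e X f) #|covered f|.

Lemma matching_funP (T : finType) (e : rel T) (X : {set T}) (f : {ffun T -> T}) :
  reflect ((forall x, f (f x) = x) /\
           (forall x, f x != x -> x \in X /\ e x (f x)))
          (matching_fun e X f).
Proof.
apply: (iffP forallP) => [h|[fK fX] x].
  split=> x; have /andP[/eqP fK /implyP fX] := h x => // /fX /andP[]; by split.
by rewrite fK eqxx; apply/implyP => /fX [-> ->].
Qed.

Lemma exists_max_matching (T : finType) (e : rel T) (X : {set T}) :
  exists2 f, matching_fun e X f & #|covered f| = max_covered e X.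
Proof.
have f0 : matching_fun e X [ffun x => x].
  by apply/matching_funP; split=> x; rewrite !ffunE ?eqxx.
rewrite /max_covered (bigmax_eq_arg _ f0).
by case: arg_maxnP => // f mf _; exists f.
Qed.

Lemma leq_max_covered (T : finType) (e : rel T) (X : {set T}) f :
  matching_fun e X f -> #|covered f| <= max_covered e X.
Proof. exact: leq_bigmax_cond. Qed.

Lemma trivIset_pairs (T : finType) (f : {ffun T -> T}) :
  (forall x, f (f x) = x) ->
  let M := [set [set x; f x] | x in covered f] in
  trivIset M /\ #|covered f| = #|M| * 2.
Proof.
move=> fK M.
have tM : trivIset M.
  apply/trivIsetP => _ _ /imsetP[x _ ->] /imsetP[y _ ->]; apply: contraNT.
  case/pred0Pn => z /andP[/= /set2P zx /set2P zy]; apply/eqP.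
  case: zx zy => -> [] h; first 1 [by rewrite h].
  - by rewrite h fK setUC.
  - by rewrite -h fK setUC.
  - by move/(congr1 f): h; rewrite !fK => ->.
have pM : partition M (covered f).
  apply/and3P; split=> //.
    rewrite eqEsubset; apply/andP; split.
      apply/bigcupsP => A /imsetP[x]; rewrite inE => xf ->.
      by apply/subsetP => y /set2P[->|->]; rewrite inE // fK eq_sym.
    apply/subsetP => x xf; apply/bigcupP; exists [set x; f x].
      exact: imset_f.
    by rewrite set21.
  by apply/imsetP => -[x _ /setP/(_ x)]; rewrite !inE eqxx.
split=> //; apply: card_uniform_partition pM => _ /imsetP[x xf ->].
by rewrite cards2 eq_sym; move: xf; rewrite inE => ->.
Qed.

(** In [tutte_berge] this parity improves a drop by one to a drop by two. *)
Lemma odd_max_covered (T : finType) (e : rel T) (X : {set T}) :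
  odd (max_covered e X) = false.
Proof.
have [f /matching_funP[fK _] <-] := exists_max_matching e X.
by have [_ ->] := trivIset_pairs fK; rewrite oddM andbF.
Qed.

Lemma max_covered_matching_number (G : sgraph) (X : {set G}) :
  max_covered (@sedge G) X <= 2 * matching_number G.
Proof.
have [f /matching_funP[fK fX] <-] := exists_max_matching (@sedge G) X.
have [tM ->] := trivIset_pairs fK; rewrite mulnC leq_pmul2l //.
apply: leq_bigmax_cond; rewrite /is_matching tM andbT.
apply/subsetP => _ /imsetP[x xf ->]; rewrite inE in xf.
by apply/imset2P; exists x (f x); rewrite // inE; have [_ ->] := fX _ xf.
Qed.

Definition max_matching_missing (T : finType) (e : rel T) (X : {set T}) u v
    (f : {ffun T -> T}) : bool :=
  [&& matching_fun e X f, #|covered f| == max_covered e X,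
      u \notin covered f & v \notin covered f].

(** The relation whose classes replace the components in [tutte_berge]. The disjunct [u == v] makes
    it reflexive also at vertices that some maximum matching misses. *)
Definition never_both_missed (T : finType) (e : rel T) (X : {set T}) u v :=
  (u == v) || [forall f, ~~ max_matching_missing e X u v f].

(** Otherwise the edge [uv] could be added to a maximum matching that misses both ends. *)
Lemma never_both_missed_edge (T : finType) (e : rel T) (X : {set T}) u v :
  symmetric e -> u \in X -> v \in X -> e u v -> never_both_missed e X u v.
Proof.
move=> esym uX vX euv; rewrite /never_both_missed.
case: (u =P v) => //= /eqP nuv; apply/forallP => f; apply/negP.
case/and4P => /matching_funP[fK fX] /eqP cf; rewrite !inE !negbK => /eqP fu /eqP fv.
pose h := [ffun x => if x == u then v else if x == v then u else f x].
have hu : h u = v by rewrite ffunE eqxx.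
have hv : h v = u by rewrite ffunE eq_sym (negPf nuv) eqxx.
have ho x : x != u -> x != v -> h x = f x.
  by rewrite ffunE => /negPf -> /negPf ->.
have fne x w : f w = w -> x != w -> f x != w.
  by move=> fw; apply: contraNneq => fxw; rewrite -(fK x) fxw fw.
have mh : matching_fun e X h.
  apply/matching_funP; split=> x;
    (have [->|xu] := eqVneq x u; [by rewrite ?hu ?hv | ]);
    (have [->|xv] := eqVneq x v; [by rewrite ?hv ?hu //; split; rewrite // esym | ]).
  - by rewrite (ho x) // ho ?fK ?fne.
  - by rewrite ho //; apply: fX.
have sub : [set u; v] :|: covered f \subset covered h.
  apply/subsetP => x; rewrite !inE -orbA.
  have [->|xu] := eqVneq x u; first by rewrite hu [v == u]eq_sym nuv.
  have [->|xv] := eqVneq x v; first by rewrite hv nuv.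
  by rewrite ho.
have := leq_max_covered mh; rewrite leqNgt -cf => /negP; apply.
apply: leq_trans (subset_leq_card sub); rewrite cardsU cards2 nuv.
rewrite (_ : _ :&: _ = set0) ?cards0; first lia.
apply/setP => x; rewrite !inE; apply/negP => /andP[/orP[]/eqP->];
  by rewrite ?fu ?fv eqxx.
Qed.

Lemma never_both_missed_sym (T : finType) (e : rel T) (X : {set T}) :
  symmetric (never_both_missed e X).
Proof.
move=> u v; rewrite /never_both_missed eq_sym; congr (_ || _).
by apply: eq_forallb => f; rewrite /max_matching_missing [(u \notin _) && _]andbC.
Qed.

(* Gallai's exchange argument: if the maximum matching [M] misses [u] and [v],
   the maximum matching [N] misses [w] and agrees with [M] as much as possible,
   then some edge [xy] of [M] with [x] missed by [N] can be exchanged for the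
   edge of [N] at [y]. *)
Lemma never_both_missed_trans (T : finType) (e : rel T) (X : {set T}) u w v f0 :
  symmetric e -> max_matching_missing e X w w f0 ->
  never_both_missed e X u w -> never_both_missed e X w v ->
  never_both_missed e X u v.
Proof.
move=> esym mf0; rewrite /never_both_missed.
case: (u =P w) => [->//|nuw /= /forallP uw].
case: (w =P v) => [<- _|nwv /= /forallP wv]; first by apply/orP; right; apply/forallP.
case: (u =P v) => //= nuv; apply/forallP => M; apply/negP => mM.
pose agree (N : {ffun T -> T}) := [set x | (N x == M x) && (M x != x)].
case: (@arg_maxnP _ f0 (max_matching_missing e X w w) (fun N => #|agree N|) mf0).
move=> N mN maxN.
have [mfM /eqP cM Mu Mv] := and4P mM.
have [MK MX] := matching_funP _ _ _ mfM.
have [mfN /eqP cN Nw _] := and4P mN.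
have [NK NX] := matching_funP _ _ _ mfN.
have Mw : w \in covered M.
  apply/negPn/negP => Mw; move: (uw M).
  by rewrite /max_matching_missing mfM cM eqxx Mu Mw.
have Nu : u \in covered N.
  apply/negPn/negP => Nu; move: (uw N).
  by rewrite /max_matching_missing mfN cN eqxx Nu Nw.
have Nv : v \in covered N.
  apply/negPn/negP => Nv; move: (wv N).
  by rewrite /max_matching_missing mfN cN eqxx Nv Nw.
(* [M] and [N] cover equally many vertices, and [N] covers [u] and [v], which [M] misses. So [M]
   covers at least two vertices missed by [N]: [w] and a further vertex [x]. *)
have : 1 < #|covered M :\: covered N|.
  have : [set u; v] \subset covered N :\: covered M.
    by apply/subsetP => x /set2P[]->; rewrite inE ?Mu ?Mv ?Nu ?Nv.
  move/subset_leq_card; rewrite cards2; case: (u =P v) => //= _.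
  have := cardsID (covered N) (covered M); have := cardsID (covered M) (covered N).
  rewrite setIC cM cN; clear; lia.
rewrite (cardsD1 w) inE Nw Mw /= ltnS => /card_gt0P[x].
rewrite !inE negbK => /and3P[xw /eqP Nx Mx].
pose y := M x.
have [_ exy] := MX _ Mx; rewrite -/y in exy.
have My : M y = x by rewrite /y MK.
have yx : y != x by [].
have [xX _] := MX _ Mx.
have [yX _] : y \in X /\ e y (M y) by apply: MX; rewrite My eq_sym.
have Ny : N y != y.
  apply/eqP => Ny; have := never_both_missed_edge esym xX yX exy.
  rewrite /never_both_missed eq_sym (negPf yx) /= => /forallP /(_ N).
  by rewrite /max_matching_missing mfN cN eqxx !inE Nx Ny !eqxx.
pose z := N y.
have Nz : N z = y by rewrite /z NK.
have zx : z != x by apply: contraNneq yx => zx; rewrite -Nz zx Nx.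
have zy : z != y by [].
(* [N'] trades the edge [yz] of [N] for the edge [xy] of [M]; it is again maximum and misses [w]. *)
pose N' := [ffun p => if p == x then y else if p == y then x
                      else if p == z then z else N p].
have N'x : N' x = y by rewrite ffunE eqxx.
have N'y : N' y = x by rewrite ffunE (negPf yx) eqxx.
have N'z : N' z = z by rewrite ffunE (negPf zx) (negPf zy) eqxx.
have N'o p : p != x -> p != y -> p != z -> N' p = N p.
  by rewrite ffunE => /negPf -> /negPf -> /negPf ->.
have Nne p q r : N q = r -> p != r -> N p != q.
  by move=> Nq; apply: contraNneq => Npq; rewrite -(NK p) Npq Nq.
have mN' : matching_fun e X N'.
  apply/matching_funP; split=> p;
    (have [->|px] := eqVneq p x; [by rewrite ?N'x ?N'y | ]);
    (have [->|py] := eqVneq p y; [by rewrite ?N'y ?N'x //; split; rewrite // esym | ]);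
    (have [->|pz] := eqVneq p z; [by rewrite ?N'z ?eqxx | ]).
  - rewrite (N'o p) // N'o ?NK //.
    + exact: Nne Nx px.
    + exact: Nne pz.
    + exact: Nne Nz py.
  - by rewrite N'o //; apply: NX.
have cN' : #|covered N'| = max_covered e X.
  have -> : covered N' = x |: (covered N :\ z).
    apply/setP => p; rewrite !inE.
    have [->|px] := eqVneq p x; first by rewrite N'x.
    have [->|py] := eqVneq p y; first by rewrite N'y eq_sym yx Ny eq_sym zy.
    by have [->|pz] := eqVneq p z; rewrite ?N'z ?eqxx ?N'o.
  rewrite cardsU1 !inE Nx eqxx !andbF -cN (cardsD1 z (covered N)).
  by rewrite inE Nz eq_sym Ny.
have mmN' : max_matching_missing e X w w N'.
  have wz : w != z.
    by apply: contraTneq Nw => ->; rewrite negbK inE Nz eq_sym.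
  have wy : w != y by apply: contraNneq Nw => ->; rewrite inE.
  rewrite /max_matching_missing mN' cN' eqxx andbb /= inE N'o //; last by rewrite eq_sym.
  by move: Nw; rewrite inE.
(* [N'] agrees with [M] on strictly more vertices: [yz] is not an edge of [M], and [x] is gained. *)
have /= := maxN _ mmN'; rewrite leqNgt => /negP; apply; apply: proper_card.
rewrite properE; apply/andP; split.
  apply/subsetP => p; rewrite !inE => /andP[/eqP NM Mp].
  have px : p != x by apply: contraNneq Mp => px; rewrite -NM px Nx.
  have py : p != y by apply: contraTneq zx => py; rewrite negbK -My -py -NM py.
  have pz : p != z.
    apply: contraTneq zx => pz; rewrite negbK -pz.
    by rewrite -[p]MK -NM pz Nz My.
  by rewrite N'o // NM eqxx.
apply/subsetPn; exists x; rewrite !inE ?N'x ?eqxx ?Mx //.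
by rewrite Nx eq_sym (negPf Mx).
Qed.

Lemma matching_funS (T : finType) (e : rel T) (X Y : {set T}) f :
  Y \subset X -> matching_fun e Y f -> matching_fun e X f.
Proof.
move=> /subsetP YX /matching_funP[fK fY]; apply/matching_funP; split=> // x.
by case/fY=> /YX.
Qed.

(* The hard half of the Tutte-Berge formula, with the components of the
   complement of [B] merged into classes of [c]. *)
Theorem tutte_berge (T : finType) (e : rel T) (X : {set T}) :
  symmetric e ->
  exists B : {set T}, exists c : T -> {set T},
    [/\ B \subset X,
        {in X :\: B &, forall x y, e x y -> c x = c y} &
        #|X| + #|B| <= max_covered e X + #|c @: (X :\: B)|].
Proof.
move=> esym; move cX: #|X| => n; elim: n X cX => [|n IH] X cX.
  exists set0; exists (fun=> set0); by rewrite sub0set cards0.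
(* Either some vertex [v] is covered by every maximum matching and moves into [B], or every vertex
   is missed by one and the classes of [never_both_missed] serve with [B] empty. *)
case: (pickP [pred v in X | [forall f, ~~ max_matching_missing e X v v f]]).
  move=> v /andP[vX /forallP noM].
  have X'X : X :\ v \subset X by apply: subsetDl.
  have cX' : #|X :\ v| = n by move: cX; rewrite (cardsD1 v) vX => -[].
  have [B [c [BX' cE card]]] := IH _ cX'.
  have setE : X :\: (v |: B) = (X :\ v) :\: B by rewrite setDDl.
  exists (v |: B), c; split; rewrite ?setE //.
    by rewrite subUset sub1set vX (subset_trans BX').
  have vB : v \notin B by apply/negP => /(subsetP BX'); rewrite !inE eqxx.
  (* A matching of [X :\ v] covering as much would be a maximum matching of [X] missing [v]. *)
  have drop : max_covered e (X :\ v) < max_covered e X.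
    have [f mf cf] := exists_max_matching e (X :\ v).
    have mfX := matching_funS X'X mf.
    have vf : v \notin covered f.
      have [_ fX'] := matching_funP _ _ _ mf.
      by rewrite inE; apply/negP => /fX' []; rewrite !inE eqxx.
    rewrite -cf ltn_neqAle leq_max_covered // andbT; apply/negP => cf'.
    by move: (noM f); rewrite /max_matching_missing mfX cf' vf.
  (* Both values are even, so the drop is at least two and pays for [v] in both [X] and [B]. *)
  have := odd_max_covered e X; have := odd_max_covered e (X :\ v).
  rewrite cardsU1 vB; lia.
move=> missed.
have missing v : v \in X -> exists f, max_matching_missing e X v v f.
  move=> vX; move: (missed v); rewrite /= vX /= => /negbT.
  by rewrite negb_forall => /existsP[f]; rewrite negbK; exists f.
pose c x := [set y in X | never_both_missed e X x y].
have cP x y : x \in X -> y \in X -> never_both_missed e X x y -> c x = c y.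
  move=> xX yX xy; have [f mf] := missing _ yX; have [g mg] := missing _ xX.
  apply/setP => z; rewrite !inE; case: (z \in X) => //=; apply/idP/idP.
    by apply: never_both_missed_trans mg _ => //; rewrite never_both_missed_sym.
  exact: never_both_missed_trans mf xy.
exists set0, c; rewrite sub0set setD0 cards0 addn0; split=> //.
  by move=> x y xX yX exy; apply: cP => //; apply: never_both_missed_edge.
(* The vertices missed by one maximum matching lie in distinct classes, so there are at least
   [#|X| - max_covered e X] classes. *)
have [f mf cf] := exists_max_matching e X; rewrite -cf.
have subX : covered f \subset X.
  have [_ fX] := matching_funP _ _ _ mf.
  by apply/subsetP => x; rewrite inE => /fX[].
rewrite -cX -(cardsID (covered f) X) (setIidPr subX) leq_add2l.
rewrite -(@card_in_imset _ _ c (X :\: covered f)).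
  by rewrite subset_leq_card // imsetS // subsetDl.
move=> x y /setDP[xX xf] /setDP[yX yf] cxy.
have : y \in c x by rewrite cxy inE yX /never_both_missed eqxx.
rewrite inE yX /never_both_missed => /orP[/eqP //|/forallP/(_ f)].
by rewrite /max_matching_missing mf cf eqxx xf yf.
Qed.

(** * The edge bound for a given [M] *)

(** [r x] depends only on [c x], so [r x == Some x] selects one representative of each fibre meeting
    [R]. *)
Lemma exists_transversal (T rT : finType) (c : T -> rT) (R : {set T}) :
  exists A : {set T}, [/\ A \subset R, {in A &, injective c} & c @: A = c @: R].
Proof.
pose r x := [pick y in R | c y == c x].
exists [set x in R | r x == Some x]; split.
- by apply/subsetP => x; rewrite inE => /andP[].
- move=> x y; rewrite !inE => /andP[_ /eqP rx] /andP[_ /eqP ry] cxy.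
  by apply: Some_inj; rewrite -rx -ry /r cxy.
apply/eqP; rewrite eqEsubset imsetS /=; last first.
  by apply/subsetP => x; rewrite inE => /andP[].
apply/subsetP => _ /imsetP[x xR ->].
case E: (r x) => [y|]; last first.
  by move: E; rewrite /r; case: pickP => // /(_ x); rewrite /= xR eqxx.
have /andP[yR /eqP cyx] : (y \in R) && (c y == c x).
  by move: E; rewrite /r; case: pickP => // z zP [<-].
rewrite -cyx; apply: imset_f; rewrite inE yR /=.
by rewrite -E /r cyx.
Qed.

Lemma degsum_le_remove (T : finType) (e : rel T) (X Y : {set T}) d :
  symmetric e -> Y \subset X -> (forall x, x \in X :\: Y -> deg e X x <= d) ->
  degsum e X <= degsum e Y + 2 * (#|X :\: Y| * d).
Proof.
move=> esym YX dd; apply: leq_trans (degsum_setD esym YX) _.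
by rewrite leq_add2l leq_pmul2l // -sum_nat_const; apply: leq_sum.
Qed.

Lemma exists_between (T : finType) (A X : {set T}) m :
  A \subset X -> #|A| <= m <= #|X| ->
  exists Y : {set T}, [/\ A \subset Y, Y \subset X & #|Y| = m].
Proof.
move=> AX /andP[]; elim: m => [|m IH] Am mX.
  by exists A; split=> //; apply/eqP; rewrite -leqn0.
have [Am'|] := leqP #|A| m; last by exists A; split=> //; lia.
have [Y [AY YX cY]] := IH Am' (ltnW mX).
have : 0 < #|X :\: Y| by have := cardsID Y X; rewrite (setIidPr YX); lia.
case/card_gt0P=> x /setDP[xX xY]; exists (x |: Y); split.
- exact: subset_trans AY (subsetUr _ _).
- by rewrite subUset sub1set xX.
- by rewrite cardsU1 xY cY.
Qed.

(** [M] is the order of the graph to which Turán's theorem is applied; it stays free because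
    different sizes of [B] call for different values. *)
Lemma bounded_matching_degsum (T : finType) (e : rel T) k s M (B : {set T})
    (c : T -> {set T}) :
  symmetric e -> irreflexive e -> 0 < k -> clique_bounded e k setT ->
  {in ~: B &, forall x y, e x y -> c x = c y} ->
  #|T| + #|B| <= 2 * s + #|c @: (~: B)| ->
  2 * s + 1 <= M + #|B| -> M <= #|T| ->
  degsum e setT <= 2 * (turan_num k M + (#|T| - M) * #|B|).
Proof.
move=> esym eirr k0 kT cE card sM MT.
have cBC : #|B| + #|~: B| = #|T| := cardsC B.
have cq : #|c @: (~: B)| <= #|~: B| by apply: leq_imset_card.
have kX (X : {set T}) : clique_bounded e k X.
  exact: clique_boundedS (subsetT X) kT.
have turanX (X : {set T}) := turan_degsum esym eirr k0 (kX X).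
have [v0 v0B] : exists v, v \in ~: B by apply/card_gt0P; lia.
case: (@arg_maxnP _ v0 [in ~: B] (deg e setT) v0B) => v vB maxv.
set D := deg e setT v in maxv *.
(* If every vertex outside [B] has degree at most [#|B|], delete down to any [M] vertices including
   [B]. *)
have [Db|bD] := leqP D #|B|.
  have [Y [BY _ cY]] : exists Y : {set T}, [/\ B \subset Y, Y \subset setT & #|Y| = M].
    by apply: exists_between; rewrite ?subsetT // cardsT MT andbT; lia.
  have degY x : x \in setT :\: Y -> deg e setT x <= #|B|.
    rewrite setTD !inE => xY; apply: leq_trans Db; apply: maxv.
    by rewrite inE; apply: contra xY; apply: (subsetP BY).
  have := degsum_le_remove esym (subsetT Y) degY.
  have -> : #|[set: T] :\: Y| = #|T| - M by rewrite setTD -cY -(cardsC Y) addKn.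
  by have := turanX Y; rewrite cY; lia.
(* [C] is the part of [v], and [Y] is kept. From the remaining parts, a transversal [Q] is deleted
   last and the rest of [R] first. *)
pose C := [set x in ~: B | c x == c v].
pose Y := B :|: C; pose R := ~: Y.
have RB x : x \in R -> x \in ~: B by rewrite !inE negb_or => /andP[].
have vC : v \in C by rewrite inE vB eqxx.
have [Q [QR cinj cQ]] := exists_transversal c R.
have cBC' : #|Y| = #|B| + #|C|.
  rewrite cardsU (_ : B :&: C = set0) ?cards0 ?subn0 //.
  by apply/setP => x; rewrite !inE; case: (x \in B).
have cYR : #|Y| + #|R| = #|T| := cardsC Y.
have qQ : #|c @: (~: B)| <= #|Q|.+1.
  rewrite -(card_in_imset cinj) cQ.
  have sub : c @: (~: B) \subset c v |: c @: R.
    apply/subsetP => _ /imsetP[x xB ->]; rewrite inE in_set1.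
    have [//|ncx] := eqVneq (c x) (c v); apply: imset_f.
    by rewrite !inE negb_or negb_and negbK (negPf ncx) orbT andbT -in_setC.
  by apply: leq_trans (subset_leq_card sub) _; rewrite cardsU1; case: (_ \notin _); lia.
have dYv : deg e Y v = D.
  rewrite /D /deg [RHS](big_setID Y) /= setTI [X in _ + X]big1 ?addn0 // => x.
  rewrite setTD => xR; case evx: (e v x) => //.
  have := cE _ _ vB (RB _ xR) evx => cvx.
  by move: xR; rewrite !inE cvx eqxx andbT orbN.
have step1 : degsum e setT <= degsum e (Y :|: Q) + 2 * (#|R :\: Q| * D).
  have -> : R :\: Q = setT :\: (Y :|: Q) by rewrite setTD setCU setDE.
  apply: degsum_le_remove; rewrite ?subsetT // => x.
  by rewrite setTD setCU => /setIP[xR _]; apply: maxv; apply: RB.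
have step2 : degsum e (Y :|: Q) <= degsum e Y + 2 * (#|Q| * #|B|).
  have QY : (Y :|: Q) :\: Y = Q.
    apply/setP => x; rewrite in_setD in_setU; case xQ: (x \in Q).
    by have := subsetP QR _ xQ; rewrite in_setC => ->; rewrite orbT.
    by case: (x \in Y).
  rewrite -{2}QY; apply: degsum_le_remove; rewrite ?subsetUl // QY => x xQ.
  (* A vertex of [Q] has no neighbour in [C] or [Q], as adjacent vertices outside [B] share their
     part; only [B] remains. *)
  apply: deg_le_card => y yYQ exy; apply/negPn/negP; rewrite -in_setC => yB.
  have xR := subsetP QR _ xQ.
  have cxy := cE _ _ (RB _ xR) yB exy.
  case/setUP: yYQ => [/setUP[yB'|]|yQ].
  - by move: yB; rewrite inE yB'.
  - rewrite inE => /andP[_ /eqP cyv]; move: xR.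
    by rewrite !inE cxy cyv eqxx andbT orbN.
  - by move: exy; rewrite (cinj _ _ xQ yQ cxy) eirr.
have cRQ : #|Q| + #|R :\: Q| = #|R| by rewrite -(cardsID Q R) (setIidPr QR).
have := turan_clones (M - #|Y|) esym eirr k0 (kX Y) (subsetP (subsetUr B C) _ vC).
have C1 : 0 < #|C| by apply/card_gt0P; exists v.
(* This bound and the next rest on [#|T| <= M + #|Q|], which combines [card], [sM] and [qQ]. *)
have MY : #|R :\: Q| <= M - #|Y| by lia.
have YM : #|Y| <= M by lia.
rewrite subnKC // dYv.
have -> : #|T| - M = #|Q| + #|R :\: Q| - (M - #|Y|) by lia.
have : M - #|Y| <= #|Q| + #|R :\: Q| by lia.
move: step1 step2 MY bD; set r := #|R :\: Q|; set y := M - #|Y|.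
move: (degsum e _) (degsum e _) (degsum e _); clearbody D r y.
move=> d1 d2 d3 s1 s2 /subnKC ry /ltnW/subnKC bD yQ.
(* Of the [y] clones, [r] make up for the deleted [R :\: Q]; the other [p] outweigh as many vertices
   of [Q], since [#|B| < D]. This leaves [#|Q| - p = #|T| - M] vertices at [#|B|] each. *)
set p := y - r in ry; set d := D - #|B| in bD.
have : #|Q| = p + (#|Q| - p) by lia.
rewrite -ry -bD; clearbody p d; nia.
Qed.

(** * Edges, cliques and matchings of an [sgraph] *)

(** Each edge arises from exactly two ordered adjacent pairs. *)
Lemma degsum_num_edges (G : sgraph) :
  degsum (@sedge G) setT = 2 * num_edges G.
Proof.
rewrite /degsum /deg.
under eq_bigr do under eq_bigl do rewrite in_setT.
rewrite (eq_bigl xpredT) => [|x]; last by rewrite in_setT.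
rewrite pair_big /= -big_mkcond /=.
rewrite (partition_big (fun p : G * G => [set p.1; p.2]) [in edges G]) /=.
  rewrite (eq_bigr (fun=> 2)) ?sum_nat_const 1?mulnC // => E.
  case/imset2P=> x y _; rewrite !inE /= => exy ->.
  have nxy : x != y by apply: contraTneq exy => ->; rewrite sedge_irrefl.
  rewrite sum1_card -(_ : #|[set (x, y); (y, x)]| = 2); last first.
    by rewrite cards2 xpair_eqE (negPf nxy).
  apply: eq_card => -[u v]; rewrite !inE unfold_in /= !xpair_eqE.
  apply/andP/orP => [[euv /eqP E2]|].
    have nuv : u != v by apply: contraTneq euv => ->; rewrite sedge_irrefl.
    have : u \in [set x; y] by rewrite -E2 set21.
    have : v \in [set x; y] by rewrite -E2 set22.
    by move: nuv => /[swap] /set2P[]-> /[swap] /set2P[]->; rewrite !eqxx; auto.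
  by case=> /andP[/eqP -> /eqP ->]; split; rewrite // ?[sedge y x]sedge_sym // setUC.
by move=> [x y] /= exy; apply/imset2P; exists x y; rewrite ?inE.
Qed.

Lemma clique_number_colouring (G : sgraph) k (h : G -> 'I_k) :
  (forall x y, sedge x y -> h x != h y) -> clique_number G <= k.
Proof.
move=> hP; apply/bigmax_leqP => A /forall_inP clA.
rewrite -[leqRHS]card_ord -(@card_in_imset _ _ h A) ?max_card // => x y xA yA.
move=> hxy; apply/eqP/negPn/negP => nxy.
have /forall_inP/(_ _ yA)/implyP/(_ nxy)/hP := clA _ xA.
by rewrite hxy eqxx.
Qed.

Lemma clique_number_bounded (G : sgraph) k :
  clique_number G <= k -> clique_bounded (@sedge G) k setT.
Proof.
move=> Gk A _ clA; apply: leq_trans Gk; apply: leq_bigmax_cond.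
apply/forall_inP => x xA; apply/forall_inP => y yA; apply/implyP.
exact: clA.
Qed.

(** Choosing a vertex of [K] in each matching edge is injective, because matching edges are
    disjoint. *)
Lemma matching_number_cover (G : sgraph) (K : {set G}) :
  (forall x y, sedge x y -> (x \in K) || (y \in K)) -> matching_number G <= #|K|.
Proof.
move=> KP; apply/bigmax_leqP => M /andP[/subsetP ME /trivIsetP tM].
pose h (E : {set G}) := [pick x in E :&: K].
have hE E : E \in M -> exists2 x, x \in E :&: K & h E = Some x.
  move/ME/imset2P => [x y _]; rewrite inE /= => exy E_xy.
  rewrite /h; case: pickP => [z zE|none]; first by exists z.
  have := KP _ _ exy; have := none x; have := none y.
  by rewrite E_xy !inE !eqxx orbT /= => -> ->.
rewrite -(@card_in_imset _ _ h M) => [|E F EM FM].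
  apply: leq_trans (leq_imset_card Some K); apply: subset_leq_card.
  apply/subsetP => _ /imsetP[E /hE[x /setIP[_ xK] ->] ->]; exact: imset_f.
have [x /setIP[xE _] ->] := hE _ EM; have [y /setIP[yF _] ->] := hE _ FM.
case=> xy; apply/eqP/negPn/negP => /(tM _ _ EM FM); rewrite disjoint_sym.
by move/disjointFr => /(_ _ yF); rewrite -xy xE.
Qed.

(** By symmetry both ends of every edge lie in [K], so a matching consists of disjoint pairs in
    [K]. *)
Lemma matching_number_support (G : sgraph) (K : {set G}) :
  (forall x y, sedge x y -> x \in K) -> 2 * matching_number G <= #|K|.
Proof.
move=> KP; rewrite mulnC -leq_divRL //; apply/bigmax_leqP => M /andP[/subsetP ME tM].
rewrite leq_divRL // -sum_nat_const.
have := tM; rewrite /trivIset => /eqP card_cover.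
rewrite (eq_bigr (fun E : {set G} => #|E|)) => [|E /ME/imset2P[x y _]].
  rewrite card_cover subset_leq_card //; apply/bigcupsP => E.
  move/ME/imset2P => [x y _]; rewrite inE /= => exy ->.
  by rewrite subUset !sub1set (KP _ _ exy) (KP y x) // sedge_sym.
rewrite inE /= => exy ->; rewrite cards2.
by case: eqP exy => // ->; rewrite sedge_irrefl.
Qed.

(** * Padding with isolated vertices *)

Definition isolated_rel (G : sgraph) m : rel (G + 'I_m)%type :=
  fun p q => match p, q with inl x, inl y => sedge x y | _, _ => false end.

Lemma isolated_sym (G : sgraph) m : symmetric (@isolated_rel G m).
Proof. by move=> [x|i] [y|j] //=; apply: sedge_sym. Qed.

Lemma isolated_irrefl (G : sgraph) m : irreflexive (@isolated_rel G m).
Proof. by move=> [x|i] //=; apply: sedge_irrefl. Qed.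

Definition add_isolated (G : sgraph) m : sgraph :=
  SGraph (@isolated_sym G m) (@isolated_irrefl G m).

Lemma num_edges_add_isolated (G : sgraph) m :
  num_edges (add_isolated G m) = num_edges G.
Proof.
apply/eqP; rewrite -(eqn_pmul2l (isT : 0 < 2)) -!degsum_num_edges; apply/eqP.
rewrite /degsum /deg big_sumType /= [X in _ + X]big1 => [|i _].
  rewrite addn0; apply: eq_big => [x|x _]; first by rewrite !inE.
  rewrite big_sumType /= [X in _ + X]big1 // addn0.
  by apply: eq_bigl => y; rewrite !inE.
by rewrite big_sumType /= !big1.
Qed.

(** * Edge counts of complete multipartite graphs *)

Lemma sum_tag (k : nat) (a F : nat -> nat) :
  \sum_(x : {i : 'I_k & 'I_(a i)}) F (tag x) = \sum_(i < k) a i * F i.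
Proof.
rewrite (eq_bigr (fun i : 'I_k => \sum_(j : 'I_(a i)) F i)) => [|i _].
  by rewrite sig_big_dep.
by rewrite sum_nat_const card_ord.
Qed.

Lemma card_tag_class (k : nat) (a : nat -> nat) (i : 'I_k) :
  \sum_(x : {i : 'I_k & 'I_(a i)}) (tag x == i) = a i.
Proof.
rewrite (sum_tag k a (fun j => j == i)) (bigD1 i) //= eqxx muln1 big1 ?addn0 // => j.
by rewrite -val_eqE /= => /negPf ->; rewrite muln0.
Qed.

(** An ordered pair of vertices either lies within one class or is adjacent. The additive form
    avoids truncated subtraction. *)
Lemma num_edges_multipartite (k : nat) (a : nat -> nat) :
  2 * num_edges (complete_multipartite k a) + \sum_(i < k) a i ^ 2 =
    (\sum_(i < k) a i) ^ 2.
Proof.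
rewrite -degsum_num_edges /degsum.
rewrite (eq_bigr (fun i : 'I_k => a i * a i)) => [|i _]; last by rewrite expnS expn1.
rewrite -(sum_tag k a a) (eq_bigl xpredT) => [|x]; last by rewrite in_setT.
rewrite -big_split /= (eq_bigr (fun=> \sum_(i < k) a i)) => [|x _].
  by rewrite sum_nat_const cardT -cardE card_complete_multipartite.
rewrite -{1}(card_tag_class a (tag x)) /deg big_mkcond -big_split /=.
rewrite -card_complete_multipartite -sum1_card; apply: eq_bigr => y _.
by rewrite in_setT /cm_rel eq_sym; case: eqP.
Qed.

Lemma sum_balanced_sq n k : 0 < k ->
  \sum_(i < k) balanced n k i ^ 2 =
    k * (n %/ k) ^ 2 + 2 * (n %% k) * (n %/ k) + n %% k.
Proof.
move=> k0; set q := n %/ k; set r := n %% k.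
have sum_r : \sum_(i < k) (i < r) = r.
  have := balanced_sum n k0; rewrite /balanced big_split /= sum_nat_const card_ord.
  by rewrite {3}(divn_eq n k) mulnC => /addnI.
rewrite (eq_bigr (fun i : 'I_k => q ^ 2 + (2 * q + 1) * (i < r))) => [|i _].
  by rewrite big_split /= sum_nat_const card_ord -big_distrr /= sum_r; lia.
rewrite /balanced -/q -/r; case: (_ < r); rewrite ?addn0 ?muln0 ?addn0 //.
by rewrite !expnS !expn0; lia.
Qed.

(** The added term is the sum of squares from [sum_balanced_sq]. The value [r = k] is allowed so
    that the induction can pass from [q] to [q.+1]. *)
Lemma turan_num_closed k q r : 0 < k -> r <= k ->
  2 * turan_num k (q * k + r) + (k * q ^ 2 + 2 * r * q + r) = (q * k + r) ^ 2.
Proof.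
move=> k0; elim: q r => [|q IHq]; elim=> [|r IHr] rk.
- by rewrite /turan_num big_ord0 !muln0.
- have := IHr (ltnW rk); rewrite !mul0n !add0n addnS turan_numS divn_small //.
  by rewrite !expnS !expn0; nia.
- have := IHq k (leqnn k); rewrite (_ : q.+1 * k + 0 = q * k + k); last lia.
  by rewrite !expnS !expn0; nia.
have := IHr (ltnW rk); rewrite addnS turan_numS divnMDl // divn_small // addn0.
set m := q.+1 * k + r; have : q.+1 <= m by rewrite /m; nia.
by rewrite !expnS !expn0; clearbody m; nia.
Qed.

Lemma t_turan_num n k : 0 < k -> t n k = turan_num k n.
Proof.
move=> k0; have := num_edges_multipartite k (balanced n k).
rewrite balanced_sum // sum_balanced_sq // -/(turan_graph n k) -/(t n k).
have := turan_num_closed (n %/ k) k0 (ltnW (ltn_pmod n k0)).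
by rewrite -divn_eq; lia.
Qed.

(** Here [m] is $s+\lceil s/d\rceil$: cutting the last class of $G(n,d+1,s)$ to $\lceil s/d\rceil$
    vertices leaves $T(m,d+1)$, and each of the other [n - m] vertices has [s] neighbours. The proof
    verifies this through sums of squares. *)
Lemma g_turan_num n d s : 0 < d ->
  let m := s + s %/ d + (0 < s %% d) in m <= n ->
  g n d.+1 s = turan_num d.+1 m + (n - m) * s.
Proof.
move=> d0 m mn; have sn : s <= n by apply: leq_trans mn; rewrite /m -addnA leq_addr.
have := num_edges_multipartite d.+1 (G_size n d.+1 s).
rewrite -/(G_graph n d.+1 s) -card_complete_multipartite card_G_graph //.
rewrite big_ord_recr /= {2}/G_size /= ltnn.
rewrite (eq_bigr (fun i : 'I_d => balanced s d i ^ 2)) => [|i _]; last first.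
  by rewrite /G_size /= ltn_ord.
rewrite sum_balanced_sq // -/(g n d.+1 s).
have rd : s %% d + (0 < s %% d) <= d.+1 by have := ltn_pmod s d0; lia.
have := turan_num_closed (s %/ d) (ltn0Sn d) rd.
have sE := divn_eq s d; move: rd.
have -> : s %/ d * d.+1 + (s %% d + (0 < s %% d)) = m by rewrite /m; lia.
have : m = s + s %/ d + (0 < s %% d) by [].
have := subnKC mn; have := subnKC sn; move: sE.
move: (s %/ d) (s %% d) (turan_num _ _) (g _ _ _) => q r tm gn.
clearbody m; move: (n - m) (n - s) => u w.
rewrite !expnS !expn0 !muln1.
(* The ceiling is [q] or [q + 1] according to whether the remainder vanishes. *)
case: r => [|r] /=; rewrite ?addn0 ?muln0 => -> nE mE h _.
  have -> : w = u + q by lia.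
  by rewrite -mE h; nia.
have -> : w = u + q + 1 by lia.
by rewrite -mE h; nia.
Qed.

(** * Convexity and the choice of [M] *)

Lemma convex_le_max (q : nat -> nat) m :
  (forall i, i.+2 <= m -> 2 * q i.+1 <= q i + q i.+2) ->
  forall i, i <= m -> q i <= maxn (q 0) (q m).
Proof.
move=> convex.
(* Stronger claim for the induction: either no value exceeds [q 0], or the last step goes strictly
   up, and convexity then forces the next one up too. *)
suff: (forall i, i <= m -> q i <= q 0) \/
    (exists2 j, m = j.+1 & q j < q m) /\
    (forall i, i <= m -> q i <= maxn (q 0) (q m)).
  by case=> [h i /h|[]//]; rewrite leq_max => ->.
elim: m convex => [|m IH] convex; first by left=> i; rewrite leqn0 => /eqP->.
have {IH} [i im|h|[[j mj qj] h]] := IH; first by apply: convex; apply: ltnW.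
  have [le|lt] := leqP (q m.+1) (q 0).
    by left=> i; rewrite leq_eqVlt => /predU1P[->//|]; rewrite ltnS => /h.
  right; split; first by exists m => //; apply: leq_ltn_trans (h m _) lt.
  move=> i; rewrite leq_eqVlt => /predU1P[->//|]; rewrite ltnS => /h qi.
  exact: leq_trans qi (ltnW lt).
have qm : q m < q m.+1.
  by have := convex j; rewrite -mj leqnn => /(_ isT); lia.
right; split; first by exists m.
move=> i; rewrite leq_eqVlt => /predU1P[->|]; first by rewrite leq_maxr.
by rewrite ltnS => /h; lia.
Qed.

(** The increments of [turan_num] do not decrease, and the product has second difference 2. In use,
    [n] stands for the number of vertices beyond [2 * s + 1]. *)
Lemma turan_num_convex k n s i : i.+2 <= 2 * s + 1 ->
  let q j := turan_num k (2 * s + 1 - j) + (n + j) * j in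
  2 * q i.+1 <= q i + q i.+2.
Proof.
move=> le /=; set m := 2 * s + 1 - i.+2.
have -> : 2 * s + 1 - i = m.+2 by lia.
have -> : 2 * s + 1 - i.+1 = m.+1 by lia.
rewrite !turan_numS.
have : m.+1 %/ k <= (m %/ k).+1.
  case: k => [|k]; first by rewrite !divn0.
  rewrite -ltnS ltn_divLR //.
  by have := ltn_ceil m (ltn0Sn k); rewrite !mulSn; clear; lia.
have := leq_div m k; have := leq_div m.+1 k; clear.
move: (m.+1 %/ k) (m %/ k) (turan_num k m) => x y z.
nia.
Qed.

Lemma edge_bound_le_max k n s b E m :
  2 * s + 1 <= n -> b <= s -> m <= 2 * s + 1 -> (0 < s -> s < m) ->
  (forall M, 2 * s + 1 <= M + b -> M <= n -> E <= turan_num k M + (n - M) * b) ->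
  E <= maxn (turan_num k (2 * s + 1)) (turan_num k m + (n - m) * s).
Proof.
move=> sn bs m2s sm EM; rewrite leq_max.
have [mb|bm] := leqP (2 * s + 1) (m + b).
  apply/orP; right; apply: leq_trans (EM m mb _) _; first exact: leq_trans m2s sn.
  by rewrite leq_add2l leq_mul2l bs orbT.
have [b0|b0] := posnP b.
  apply/orP; left; have := EM (2 * s + 1); rewrite b0 muln0 addn0 addn0.
  by apply.
(* [q j] is the bound for [b = j] with the least permitted [M], namely [2 * s + 1 - j]. *)
pose q j := turan_num k (2 * s + 1 - j) + (n - (2 * s + 1) + j) * j.
have conv i : i.+2 <= 2 * s + 1 - m -> 2 * q i.+1 <= q i + q i.+2.
  by move=> le; apply: turan_num_convex; lia.
have b_le : b <= 2 * s + 1 - m by lia.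
have := convex_le_max conv (i := b) _; rewrite leq_max => /(_ b_le).
have Eq : E <= q b.
  rewrite /q (_ : n - _ + b = n - (2 * s + 1 - b)); last lia.
  by apply: EM; lia.
rewrite {2 4}/q muln0 addn0 subn0 subKn //.
case/orP=> [/(leq_trans Eq) -> //|/(leq_trans Eq) Em].
(* At the right end the factor is [2 * s + 1 - m], at most [s] because [s < m]; here [0 < s] follows
   from [0 < b <= s]. *)
apply/orP; right; apply: leq_trans Em _; rewrite leq_add2l.
by apply: leq_mul; lia.
Qed.

(** * Upper bounds for the number of edges *)

Lemma num_edges_le_turan n k (G : sgraph) : 0 < k ->
  #|G| = n -> clique_number G <= k -> num_edges G <= t n k.
Proof.
move=> k0 cG Gk; rewrite t_turan_num // -(leq_pmul2l (isT : 0 < 2)).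
rewrite -degsum_num_edges -cG -cardsT; apply: turan_degsum => //.
- exact: sedge_sym.
- exact: sedge_irrefl.
- exact: clique_number_bounded.
Qed.

Lemma num_edges_le_max n k s (G : sgraph) : 1 < k -> 2 * s + 1 <= n ->
  admissible n k s G -> num_edges G <= maxn (t (2 * s + 1) k) (g n k s).
Proof.
move=> k1 sn [cG Gk Gs]; have k0 := ltnW k1.
have esym := @sedge_sym G; have eirr := @sedge_irrefl G.
have [B [c [_ cE card]]] := tutte_berge setT esym.
rewrite setTD cardsT in cE card.
have mc := max_covered_matching_number [set: G].
have cq : #|c @: (~: B)| <= #|~: B| by apply: leq_imset_card.
have cBC : #|B| + #|~: B| = #|G| := cardsC B.
case: k k1 k0 Gk => [//|d] d0 _ Gk; rewrite ltnS in d0.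
pose m := s + s %/ d + (0 < s %% d).
have sE := divn_eq s d.
have m2s : m <= 2 * s.
  by rewrite /m; case: (s %% d) sE => [|r] /= sE; nia.
rewrite t_turan_num // g_turan_num // -/m; last lia.
(* [#|B| <= s] holds since there are at most [#|~: B|] classes. *)
apply: (@edge_bound_le_max _ _ _ #|B|) => //; try lia.
  rewrite /m; case: (s %% d) sE => [|r] /= sE s0; last by rewrite addn1 ltnS leq_addr.
  by rewrite addn0 -addn1 leq_add2l; case: (s %/ d) sE s0 => [->|q].
move=> M sM Mn; rewrite -(leq_pmul2l (isT : 0 < 2)) -degsum_num_edges -cG.
apply: (@bounded_matching_degsum _ _ _ s _ _ c) => //; try lia.
exact: clique_number_bounded.
Qed.

(** * The extremal graphs *)

Lemma admissible_turan n k s : 0 < k -> n <= 2 * s + 1 ->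
  admissible n k s (turan_graph n k).
Proof.
move=> k0 ns; split; first exact: card_turan_graph.
  by apply: (@clique_number_colouring (turan_graph n k) k (fun x => tag x)).
have := @matching_number_support (turan_graph n k) setT.
by move=> /(_ (fun x y _ => in_setT x)); rewrite cardsT card_turan_graph //; lia.
Qed.

Lemma admissible_turan_isolated n k s : 0 < k -> 2 * s + 1 <= n ->
  admissible n k s (add_isolated (turan_graph (2 * s + 1) k) (n - (2 * s + 1))).
Proof.
move=> k0 sn; set T := turan_graph _ _; set l := n - _.
split; first by rewrite card_sum card_ord card_turan_graph // subnKC.
  pose h (p : add_isolated T l) : 'I_k :=
    match p with inl x => tag x | inr _ => Ordinal k0 end.
  by apply: (@clique_number_colouring _ _ h) => [[x|i] [y|j]].
pose K : {set add_isolated T l} := [set inl x | x in [set: T]].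
have : 2 * matching_number (add_isolated T l) <= #|K|.
  by apply: matching_number_support => -[x|i] [y|j] //= _; apply: imset_f.
have := leq_imset_card (inl : T -> add_isolated T l) [set: T].
by rewrite cardsT card_turan_graph // -/K; lia.
Qed.

Lemma admissible_G n k s : 1 < k -> s <= n -> admissible n k s (G_graph n k s).
Proof.
move=> k1 sn; split; first exact: card_G_graph.
  by apply: (@clique_number_colouring (G_graph n k s) k (fun x => tag x)).
case: k k1 => [//|d] d0; set G := G_graph _ _ _.
(* [ord_max] is the index of the class of size [n - s]; the other classes contain [s] vertices and
   meet every edge. *)
pose K : {set G} := ~: [set x : G | tag x == ord_max].
have cK : #|K| = s.
  have cG : #|G| = n by apply: card_G_graph.
  have := cardsC [set x : G | tag x == ord_max]; rewrite cG -/K.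
  have <- : \sum_(x : G) (tag x == ord_max) = #|[set x : G | tag x == ord_max]|.
    by rewrite -sum1_card [RHS]big_mkcond; apply: eq_bigr => x _; rewrite inE; case: eqP.
  by rewrite card_tag_class /G_size /= ltnn; lia.
rewrite -cK; apply: matching_number_cover => x y xy; rewrite !inE -negb_and.
by apply: contraL xy => /andP[/eqP xm /eqP ym]; rewrite /= /cm_rel xm ym eqxx.
Qed.

Theorem theorem1p1 (k s n : nat) (hk : 2 <= k) (hs : 0 <= s) (hn : 1 <= n) :
  (2 * s + 1 <= n ->
     is_max_num_edges n k s (maxn (t (2 * s + 1) k) (g n k s))) /\
  (n <= 2 * s + 1 -> is_max_num_edges n k s (t n k)).
Proof.
have k0 := ltnW hk; split=> sn; split.
- have [tg|gt] := leqP (t (2 * s + 1) k) (g n k s).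
    by exists (G_graph n k s) => //; apply: admissible_G => //; lia.
  exists (add_isolated (turan_graph (2 * s + 1) k) (n - (2 * s + 1))).
    exact: admissible_turan_isolated.
  exact: num_edges_add_isolated.
- by move=> G; apply: num_edges_le_max.
- by exists (turan_graph n k) => //; apply: admissible_turan.
- by move=> G [cG Gk _]; apply: num_edges_le_turan.
Qed.
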